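(* Let $n\in\mathbb{Z}^+$ be even with $n\geq 4$. The Möbius ladder $M_n$ is a cubic 3-balanced graph if and only if $6\mid n$.
   Context: For even $n\geq 4$, the Möbius ladder $M_n$ is the graph obtained from an $n$-cycle $v_1v_2\cdots v_nv_1$ by adding the edges $v_iv_{i+n/2}$ joining opposite vertices. A graph is 3-balanced if it admits a vertex coloring $\ell:V\to\mathbb{Z}_3$ such that every vertex has, in its open neighborhood, the same number of vertices of each of the three colors. *)

(* Defs.v *)
From mathcomp Require Import all_boot all_algebra.

Set Implicit Arguments.
Unset Strict Implicit.
Unset Printing Implicit Defensive.

(* Finite simple graphs. *)
Record sgraph := SGraph {
  vertex :> finType;
  adj : rel vertex;
  adj_sym : symmetric adj;
  adj_irrefl : irreflexive adj
}.

Definition open_nbh (G : sgraph) (v : G) : {set G} := [set u | adj v u].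

Definition cubic (G : sgraph) : Prop := forall v : G, #|open_nbh v| = 3.

Definition balanced3 (G : sgraph) : Prop :=
  exists l : G -> 'Z_3, forall (v : G) (a b : 'Z_3),
    #|[set u in open_nbh v | l u == a]| = #|[set u in open_nbh v | l u == b]|.

Section MobiusLadder.

Variable n : nat.

(* Vertices are numbered from 0: v_(i+1) is represented by i : 'I_n, and
   indices are read modulo n. *)
Definition mobius_link (i j : 'I_n) : bool :=
  (j == i.+1 %% n :> nat) || (j == (i + n./2) %% n :> nat).

(* The condition i != j is automatic for n >= 2; it is there so that the
   ladder is a simple graph for every n. *)
Definition mobius_adj (i j : 'I_n) : bool :=
  (i != j) && (mobius_link i j || mobius_link j i).

Lemma mobius_adj_sym : symmetric mobius_adj.
Proof. by move=> i j; rewrite /mobius_adj eq_sym orbC. Qed.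

Lemma mobius_adj_irrefl : irreflexive mobius_adj.
Proof. by move=> i; rewrite /mobius_adj eqxx. Qed.

Definition mobius_ladder : sgraph := SGraph mobius_adj_sym mobius_adj_irrefl.

End MobiusLadder.

(* Main.v *)
Require Import Defs.
From mathcomp Require Import all_boot all_algebra.
From mathcomp Require Import zify.

(* If a cubic graph is 3-balanced, every vertex has exactly one neighbor of
   each color; counting the edges that end in a fixed color class C in two ways
   gives #|V| = 3 * #|C|, so 3 divides the order.  Conversely, if 6 %| n then
   n./2 = 0 %[mod 3], so coloring each vertex by its index modulo 3 gives the
   neighbors i + 1, i - 1, i + n./2 of i the three residues i + 1, i + 2, i. *)

Lemma card_nbh_color (G : sgraph) (l : G -> 'Z_3) (v : G) (a : 'Z_3) :
  #|[set u in open_nbh v | l u == a]| = \sum_(u in open_nbh v) (l u == a).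
Proof.
by rewrite -sum1dep_card big_mkcondr /=; apply: eq_bigr => u _; case: eqP.
Qed.

Lemma cubic_balanced3_dvd (G : sgraph) : cubic G -> balanced3 G -> 3 %| #|G|.
Proof.
move=> G_cubic [l l_bal].
have one_nbh v : \sum_(u in open_nbh v) (l u == ord0) = 1.
  have same a :
      \sum_(u in open_nbh v) (l u == ord0) = \sum_(u in open_nbh v) (l u == a).
    by rewrite -!card_nbh_color; apply: l_bal.
  (* Over all colors, each of the three neighbors is counted once, under its own color; the common
     count is thus 1. *)
  have: \sum_(a : 'Z_3) \sum_(u in open_nbh v) (l u == ord0) = 3.
    rewrite (eq_bigr _ (fun a _ => same a)) exchange_big -[RHS](G_cubic v) -sum1_card.
    apply: eq_bigr => u _.
    by rewrite (bigD1 (l u)) //= eqxx big1 // => a /negPf; rewrite eq_sym => ->.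
  by rewrite sum_nat_const card_ord /Zp_trunc /=; lia.
have -> : #|G| = \sum_(u : G) (l u == ord0) * 3.
  (* Each vertex [v] is counted through its unique neighbor of color 0; after the exchange, such a
     neighbor [u] is counted once per adjacent vertex. *)
  rewrite -sum1_card -(eq_bigr _ (fun v _ => one_nbh v)).
  rewrite (exchange_big_dep predT) //=; apply: eq_bigr => u _.
  rewrite sum_nat_const mulnC; congr (_ * _); rewrite -[RHS](G_cubic u).
  by apply: eq_card => v; rewrite inE [LHS]inE adj_sym.
by apply: dvdn_sum => u _; apply: dvdn_mull.
Qed.

Lemma ord_gt0 n (i : 'I_n) : 0 < n.
Proof. exact: leq_ltn_trans (ltn_ord i). Qed.

Definition ord_shift n (i : 'I_n) (d : nat) : 'I_n :=
  Ordinal (ltn_pmod (i + d) (ord_gt0 n i)).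

(** Shifting by [n.-1] modulo [n] is the step back along the cycle, free of truncated
    subtraction. *)
Definition mobius_nbrs n (i : 'I_n) : seq 'I_n :=
  [:: ord_shift n i 1; ord_shift n i n.-1; ord_shift n i n./2].

(** Trades the variable modulus for a case split that [lia] can handle. *)
Lemma modnD_lt n i d : i < n -> d < n ->
  (i + d) %% n = if i + d < n then i + d else i + d - n.
Proof.
move=> i_lt d_lt; case: ltnP => [/modn_small //|le_n].
by rewrite -{1}(subnK le_n) modnDr modn_small //; lia.
Qed.

Section MobiusNeighbors.

Variables (n : nat) (n_even : ~~ odd n) (n_ge4 : 4 <= n).

(** The shifts are distinct modulo [n] since 1 < n/2 < n - 1 < n for even n >= 4. *)
Lemma mobius_nbrs_uniq (i : 'I_n) : uniq (mobius_nbrs n i).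
Proof.
have i_lt := ltn_ord i; have n_half : n = n./2 + n./2 by rewrite addnn even_halfK.
rewrite /= !inE -!val_eqE /=; move: (n./2) n_half => h n_half.
have [n_gt1 p_lt h_lt] : [/\ 1 < n, n.-1 < n & h < n] by split; lia.
by rewrite !modnD_lt //; repeat case: ltnP => ?; lia.
Qed.

(** As n/2 + n/2 = n, the opposite link is its own reverse, so four link cases give three
    neighbors. *)
Lemma open_nbh_mobius (i : mobius_ladder n) : open_nbh i =i mobius_nbrs n i.
Proof.
move=> j; have i_lt := ltn_ord i; have j_lt := ltn_ord j.
have n_half : n = n./2 + n./2 by rewrite addnn even_halfK.
rewrite !inE /= /mobius_adj /mobius_link -!val_eqE /= -(addn1 i) -(addn1 j).
move: (nat_of_ord i) (nat_of_ord j) (n./2) n_half i_lt j_lt.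
move=> {i j} i j h n_half i_lt j_lt.
have [n_gt1 p_lt h_lt] : [/\ 1 < n, n.-1 < n & h < n] by split; lia.
rewrite !modnD_lt //.
by apply/idP/idP => [/andP[_ /orP[/orP[]|/orP[]]] /eqP | /or3P[] /eqP];
  repeat case: ltnP => ?; lia.
Qed.

Lemma mobius_cubic : cubic (mobius_ladder n).
Proof.
by move=> i; rewrite (eq_card (open_nbh_mobius i)) (card_uniqP (mobius_nbrs_uniq i)).
Qed.

Lemma mobius_balanced3 : 6 %| n -> balanced3 (mobius_ladder n).
Proof.
move=> n_dvd6; exists (fun i : 'I_n => inZp i) => i a b.
suff one_nbh c :
    #|[set u : mobius_ladder n in open_nbh i | inZp (u : 'I_n) == c :> 'Z_3]| = 1.
  by rewrite !one_nbh.
rewrite card_nbh_color (eq_bigl _ _ (open_nbh_mobius i)).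
rewrite -(big_uniq _ (mobius_nbrs_uniq i)) /= !big_cons big_nil -!val_eqE /=.
(* Since 3 divides [n], reducing an index modulo [n] keeps its color. *)
rewrite !(modn_dvdm _ (dvdn_trans _ n_dvd6)) //.
have := ltn_ord c; rewrite /Zp_trunc /=; lia.
Qed.

End MobiusNeighbors.

Theorem theorem6p1 (n : nat) (n_even : ~~ odd n) (n_ge4 : 4 <= n) :
  (cubic (mobius_ladder n) /\ balanced3 (mobius_ladder n)) <-> 6 %| n.
Proof.
split=> [[Mn_cubic Mn_bal] | n_dvd6]; last first.
  by split; [apply: mobius_cubic | apply: mobius_balanced3].
have := cubic_balanced3_dvd _ Mn_cubic Mn_bal; rewrite /= card_ord.
(* Evenness of [n] turns 3 | n into 6 | n. *)
lia.
Qed.
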